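(* Let $k$ and $m$ be positive integers. Then $$D_{2k-1,2-k-m,t}(N) = 0 \quad \text{for } N = 1, 2, \ldots, m+k-2,$$ and for all $n \in \mathbb{N}=\{0,1,2,\dots\}$ $$D_{2k-1,2-k-m,t}(n+m+k-1) = (-1)^{\binom{m+k-1}{2}}\, t^{kn}\, D_{2k-1,1-k+m,t}(n).$$
   Context: Here $t$ is an indeterminate and all identities are identities of polynomials in $t$. The Narayana polynomials are $C_0(t)=1$ and $C_n(t) = \sum_{j=0}^{n-1} \binom{n}{j}\binom{n-1}{j}\frac{1}{j+1} t^j$ for $n>0$. Define the formal power series in $x$ $$c_0(x,t) = \sum_{n\ge 0} C_n(t) x^n, \qquad c_1(x,t) = 1 + t\sum_{n\ge 1} C_n(t) x^n .$$ Define $c(x,t)^{(k)}$ for integers $k \ge 0$ by $c(x,t)^{(0)}=1$, $c(x,t)^{(2k+1)} = c(x,t)^{(2k)} c_0(x,t)$ for $k\ge 0$, and $c(x,t)^{(2k)} = c(x,t)^{(2k-1)} c_1(x,t)$ for $k \ge 1$ (so $c(x,t)^{(2k)} = c_0(x,t)^k c_1(x,t)^k$ and $c(x,t)^{(2k+1)} = c_0(x,t)^{k+1}c_1(x,t)^k$). Let $C_{k,n}(t) = [x^n]\, c(x,t)^{(k)}$ be the coefficient of $x^n$ for $n \ge 0$, and $C_{k,n}(t)=0$ for $n<0$. For $M\in\mathbb{Z}$ and integers $K,N\ge 1$ define $$D_{K,M,t}(N) = \det\left(C_{K,i+j+M}(t)\right)_{i,j=0}^{N-1},$$ and set $D_{K,M,t}(0)=1$.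 A range $N=1,\dots,r$ with $r\le 0$ is empty. *)

(* Defs.v *)
From mathcomp Require Import all_boot all_order all_algebra.

Set Implicit Arguments.
Unset Strict Implicit.
Unset Printing Implicit Defensive.

Import GRing.Theory.
Local Open Scope ring_scope.

(* The indeterminate t is 'X in {poly rat}; the coefficients of narayana n are
   integers, but are written with a division, hence the base ring rat. *)

Definition narayana (n : nat) : {poly rat} :=
  if n is n'.+1 then
    \sum_(j < n'.+1) ('C(n'.+1, j)%:R * 'C(n', j)%:R * (j.+1%:R)^-1) *: 'X^j
  else 1.

(* A formal power series in x over Q[t], given by its sequence of coefficients:
   f n is [x^n] f. *)
Definition fps := nat -> {poly rat}.

Definition fps_one : fps := fun n => if n == 0%N then 1 else 0.

Definition fps_mul (f g : fps) : fps :=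
  fun n => \sum_(i < n.+1) f i * g (n - i)%N.

Definition c0 : fps := fun n => narayana n.

Definition c1 : fps := fun n => if n == 0%N then 1 else 'X * narayana n.

(* The factors alternate c0, c1, c0, c1, ..., starting with c0. *)
Fixpoint cpow (k : nat) : fps :=
  if k is k'.+1 then fps_mul (cpow k') (if odd k' then c1 else c0)
  else fps_one.

Definition Ccoef (k : nat) (n : int) : {poly rat} :=
  match n with
  | Posz n' => cpow k n'
  | Negz _ => 0
  end.

(* For N = 0 the determinant of the empty matrix is 1. *)
Definition hankelD (K : nat) (M : int) (N : nat) : {poly rat} :=
  \det (\matrix_(i < N, j < N) Ccoef K ((i : nat)%:Z + (j : nat)%:Z + M)).

(* Main.v *)
From HB Require Import structures.
Require Import Defs.
From mathcomp Require Import all_boot all_order all_algebra.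
From mathcomp Require Import boolp.
From mathcomp Require Import zify ring.
Import GRing.Theory.
Local Open Scope ring_scope.

(** Put F = c0^k c1^(k-1), the series whose coefficients fill the Hankel
    matrices, and p = k + m - 2. The entry (i, j) of the left-hand matrix is
    the coefficient of x^(i+j-p) in F, so for N <= p its first row vanishes.
    For larger N two facts combine.

    First, Hankel determinants of F and of 1/F determine each other
    ([hankel_reciprocal]): multiplying the Hankel matrix of x^p F, of size
    p+1+n, by the unitriangular Toeplitz matrix of 1/F makes it block
    triangular. One diagonal block is an antidiagonal of ones, which gives the
    sign (-1)^binom(p+1, 2); the other is minus the Hankel matrix of size n of
    the coefficients of 1/F from index p+2 on, times a unitriangular matrix.

    Second, 1/F is a multiple of F, up to a shift and a low degree part
    ([cpow_inv_coef]). Put u = x c0 c1. Then c0 = 1 + u and c1 = 1 + t u, so u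
    is a root of t x u^2 + ((1 + t) x - 1) u + x = 0, and the conjugate root
    is u' = 1/(t u). Conjugation takes F to t^(-k) x^(1-2k) / F. As F is a
    polynomial in u, the sum of F and its conjugate is a polynomial in 1/x, and
    therefore 1/F + t^k x^(2k-1) F is a polynomial in x. A closer look bounds
    its degree by k ([conj_sum_deg]), so beyond index k the coefficients of
    1/F are those of - t^k x^(2k-1) F. Since p + 2 > k, the Hankel matrix of
    1/F is - t^k times the one on the right-hand side of the theorem.

    The relations between c0 and c1 come from the closed form of the Narayana
    polynomials: its binomials give a three-term recurrence
    ([narayana_rec]), that is, a linear differential equation for c0. The
    quadratic equation for c0 follows because the discriminant and the square
    of 2 t x c0 - (1 - (1 - t) x) solve the same first order equation with the
    same constant term. *)

(** * Hankel determinants of a series and of its reciprocal *)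

Lemma det_antidiagonal (R : comNzRingType) (p : nat) :
  \det (\matrix_(i < p, j < p) ((i + j).+1 == p)%:R) = (-1) ^+ 'C(p, 2) :> R.
Proof.
elim: p => [|p IHp]; first by rewrite det_mx00.
rewrite (expand_det_row _ ord0) (bigD1 ord_max) //= big1 => [|j jp].
  rewrite mxE /= add0n eqxx mul1r addr0 /cofactor add0n binS bin1 exprD mulrC.
  rewrite -IHp; congr (\det _ * _); apply/matrixP => i j; rewrite !mxE /=.
  by rewrite /bump [(p <= j)%N]leqNgt ltn_ord add0n add1n addSn eqSS.
rewrite mxE add0n eqSS (_ : (_ == _) = false) ?mul0r //.
by apply: contraNF jp => /eqP jp; apply/eqP/val_inj.
Qed.

(** Here b is the reciprocal of the series a. Row operations by the Toeplitz
    matrix T of b replace every entry of the Hankel matrix by a partial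
    convolution of a and b. In the first p+1 columns the convolution is
    complete, hence a coefficient of the series 1; in the later columns it is
    minus the missing tail of a complete convolution, and these tails form the
    product of a Hankel matrix of b with a unitriangular matrix U. *)
Lemma hankel_reciprocal (R : comNzRingType) (a b : nat -> R) (p n : nat) :
    a 0%N = 1 ->
    (forall l : nat, \sum_(i < l.+1) b i * a (l - i)%N = (l == 0%N)%:R) ->
  \det (\matrix_(i < p.+1 + n, j < p.+1 + n)
          (if (p <= i + j)%N then a (i + j - p)%N else 0))
  = (-1) ^+ 'C(p.+1, 2) * (-1) ^+ n
      * \det (\matrix_(i < n, j < n) b (i + j + p.+2)%N).
Proof.
move=> a0 ba.
have b0 : b 0%N = 1 by have := ba 0%N; rewrite big_ord1 a0 mulr1.
set H := matrix_of_fun _ _.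
pose T := \matrix_(i < p.+1 + n, j < p.+1 + n)
   (if (j <= i)%N then b (i - j)%N else 0).
pose U := \matrix_(i < n, j < n) (if (i <= j)%N then a (j - i)%N else 0).
have detT : \det T = 1.
  rewrite det_trig; last first.
    by apply/is_trig_mxP => i j ij; rewrite mxE leqNgt ij.
  by rewrite big1 // => i _; rewrite mxE leqnn subnn.
have detU : \det U = 1.
  rewrite -det_tr det_trig; last first.
    by apply/is_trig_mxP => i j ij; rewrite !mxE leqNgt ij.
  by rewrite big1 // => i _; rewrite !mxE leqnn subnn.
(* The coefficients of x^p times the series a. *)
pose a' (l : nat) := if (p <= l)%N then a (l - p)%N else 0.
have TH_entry i j : (T *m H) i j = \sum_(l < i.+1) b l * a' (i + j - l)%N.
  rewrite mxE (eq_bigr (fun l : 'I_(p.+1 + n) =>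
    if (l <= i)%N then b (i - l)%N * a' (l + j)%N else 0)); last first.
    by move=> l _; rewrite !mxE; case: ifP; rewrite ?mul0r.
  rewrite -(big_mkord xpredT
    (fun l => if (l <= i)%N then b (i - l)%N * a' (l + j)%N else 0)).
  rewrite (big_cat_nat (n := i.+1)) //= [X in _ + X]big_nat_cond.
  rewrite [X in _ + X]big1 ?addr0 => [|l]; last first.
    by case/andP=> /andP[il _] _; rewrite leqNgt il.
  rewrite big_mkord (reindex_inj rev_ord_inj) /=; apply: eq_bigr => l _.
  rewrite subSS leq_subr subKn -1?ltnS //.
  by congr (_ * a' _); have := ltn_ord l; lia.
(* For j <= p the column j gives complete convolutions. *)
have full (l i j : nat) : (i + j = l + p)%N -> (l <= i)%N ->
    \sum_(r < i.+1) b r * a' (i + j - r)%N = (l == 0%N)%:R.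
  move=> ijl li; rewrite -ba.
  rewrite -(big_mkord xpredT (fun r => b r * a' (i + j - r)%N)).
  rewrite (big_cat_nat (n := l.+1)) //= [X in _ + X]big_nat_cond.
  rewrite [X in _ + X]big1 ?addr0 => [|r]; last first.
    case/andP=> /andP[lr ri] _; rewrite /a'.
    by case: leqP; rewrite ?mulr0 //; lia.
  rewrite big_mkord; apply: eq_bigr => r _.
  have rl : (r <= l)%N by rewrite -ltnS.
  by rewrite /a' ijl; case: leqP; [move=> _; congr (_ * a _) | ]; lia.
have -> : \det H = \det (T *m H) by rewrite det_mulmx detT mul1r.
have -> : T *m H = block_mx
   (\matrix_(i < p.+1, j < p.+1) ((i + j).+1 == p.+1)%:R) (ursubmx (T *m H))
   0 (- ((\matrix_(i < n, j < n) b (i + j + p.+2)%N) *m U)).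
  rewrite -[LHS]submxK; congr block_mx; apply/matrixP => i j;
    rewrite 2!mxE TH_entry.
  - rewrite mxE /=; case: (leqP p (i + j)) => pij.
      rewrite (full (i + j - p)%N) ?eqSS ?subnK //; last first.
        by have := ltn_ord j; lia.
      by congr (nat_of_bool _)%:R; lia.
    rewrite big1 => [|l _]; first by rewrite eqSS ltn_eqF.
    by rewrite /a' leqNgt (leq_ltn_trans (leq_subr _ _) pij) mulr0.
  - rewrite mxE /= (full (p.+1 + i + j - p)%N) ?subnK //.
    + by case: eqP => //; lia.
    + lia.
    + have := ltn_ord j; lia.
  - rewrite !mxE /=.
    have jn : (j.+1 <= n)%N by [].
    have tail :
        \sum_(s < n) (\matrix_(i0, j0) b (i0 + j0 + p.+2)%N) i s * U s j
        = \sum_(0 <= s < j.+1) b (i + s + p.+2)%N * a (j - s)%N.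
      rewrite (big_nat_widen _ _ _ _ _ jn) big_mkord [RHS]big_mkcond /=.
      apply: eq_bigr => s _; rewrite !mxE ltnS.
      by case: ifP; rewrite ?mulr0.
    have := ba (i + j + p.+2)%N.
    rewrite addnS -(big_mkord xpredT (fun r => b r * a (_ - r)%N)).
    rewrite (@big_cat_nat _ _ _ (p.+1 + i).+1) //=; last by lia.
    rewrite -{2}[(p.+1 + i).+1]add0n big_addn.
    have -> : ((i + j + p.+1).+2 - (p.+1 + i).+1 = j.+1)%N by lia.
    move/eqP; rewrite addr_eq0 tail => /eqP.
    rewrite big_mkord => head.
    transitivity (\sum_(l < (p.+1 + i).+1) b l * a ((i + j + p.+1).+1 - l)%N).
      apply: eq_bigr => l _; rewrite /a'; have := ltn_ord l => lb.
      by case: leqP => pl; [congr (_ * a _)|]; lia.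
    rewrite head; congr (- _); apply: eq_bigr => s _.
    by congr (b _ * a _); lia.
rewrite det_ublock det_antidiagonal -scaleN1r detZ det_mulmx detU mulr1.
by rewrite mulrA.
Qed.

(** * The ring of formal power series *)

(** Truncation reduces the ring axioms of the Cauchy product to those of
    polynomials. *)
Lemma fps_mul_trunc (N n : nat) (f g : fps) : (n < N)%N ->
  fps_mul f g n = (\poly_(i < N) f i * \poly_(i < N) g i)`_n.
Proof.
move=> nN; rewrite coefM; apply: eq_bigr => i _.
by rewrite !coef_poly !(leq_ltn_trans _ nN) ?leq_subr -1?ltnS.
Qed.

Definition fps_add (f g : fps) : fps := fun n => f n + g n.
Definition fps_opp (f : fps) : fps := fun n => - f n.
Definition fps_zero : fps := fun=> 0.

Fact fps_addA : associative fps_add.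
Proof. by move=> f g h; apply/funext => n; rewrite /fps_add addrA. Qed.
Fact fps_addC : commutative fps_add.
Proof. by move=> f g; apply/funext => n; rewrite /fps_add addrC. Qed.
Fact fps_add0 : left_id fps_zero fps_add.
Proof. by move=> f; apply/funext => n; rewrite /fps_add add0r. Qed.
Fact fps_addN : left_inverse fps_zero fps_opp fps_add.
Proof. by move=> f; apply/funext => n; rewrite /fps_add /fps_opp addNr. Qed.

Fact fps_mulA : associative fps_mul.
Proof.
move=> f g h; apply/funext => n.
have trM u v i : (i <= n)%N -> fps_mul u v i =
    (\poly_(j < n.+1) u j * \poly_(j < n.+1) v j)`_i.
  by move=> ?; apply: fps_mul_trunc.
transitivity ((\poly_(j < n.+1) f j * (\poly_(j < n.+1) g j
                * \poly_(j < n.+1) h j))`_n).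
  rewrite coefM; apply: eq_bigr => i _.
  by rewrite coef_poly ltn_ord trM ?leq_subr.
rewrite mulrA coefM; apply: eq_bigr => i _.
by rewrite coef_poly ltnS leq_subr trM -1?ltnS.
Qed.

Fact fps_mulC : commutative fps_mul.
Proof.
by move=> f g; apply/funext => n; rewrite !(fps_mul_trunc n.+1) ?ltnSn // mulrC.
Qed.

Fact fps_mul1 : left_id fps_one fps_mul.
Proof.
move=> f; apply/funext => n; rewrite /fps_mul big_ord_recl /= mul1r subn0.
by rewrite big1 ?addr0 // => i _; rewrite /fps_one mul0r.
Qed.

Fact fps_mulDl : left_distributive fps_mul fps_add.
Proof.
move=> f g h; apply/funext => n; rewrite /fps_mul /fps_add -big_split /=.
by apply: eq_bigr => i _; rewrite mulrDl.
Qed.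

Fact fps_one_neq0 : fps_one <> fps_zero.
Proof. by move/(congr1 (@^~ 0%N))/eqP; rewrite oner_eq0. Qed.

HB.instance Definition _ := gen_eqMixin fps.
HB.instance Definition _ := gen_choiceMixin fps.
HB.instance Definition _ :=
  GRing.isZmodule.Build fps fps_addA fps_addC fps_add0 fps_addN.
HB.instance Definition _ := GRing.Zmodule_isComNzRing.Build fps
  fps_mulA fps_mulC fps_mul1 fps_mulDl (introN eqP fps_one_neq0).

(** * The three-term recurrence of the Narayana polynomials *)

Lemma coef_narayana (n j : nat) :
  (narayana n.+1)`_j = 'C(n.+1, j)%:R * 'C(n, j)%:R / j.+1%:R.
Proof.
rewrite /narayana.
rewrite -(poly_def _ (fun j => 'C(n.+1, j)%:R * 'C(n, j)%:R / j.+1%:R)).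
rewrite coef_poly; case: ltnP => // nj.
by rewrite (@bin_small n j nj) mulr0 mul0r.
Qed.

(** The differences are taken in rat rather than in nat, which makes this
    formula and the next one valid for j > n as well. *)
Lemma natr_bin_left (n j : nat) :
  'C(n, j.+1)%:R = (n%:R - j%:R) / j.+1%:R * 'C(n, j)%:R :> rat.
Proof.
apply: (@mulfI _ (j.+1%:R)); first by rewrite Num.Theory.pnatr_eq0.
rewrite -natrM mul_bin_left natrM mulrA mulrCA.
rewrite divff ?Num.Theory.pnatr_eq0 // mulr1.
by case: (leqP j n) => jn; [rewrite natrB | rewrite bin_small // !mulr0].
Qed.

Lemma natr_bin_down (n j : nat) :
  'C(n, j)%:R = (n.+1%:R - j%:R) / n.+1%:R * 'C(n.+1, j)%:R :> rat.
Proof.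
apply: (@mulfI _ (n.+1%:R)); first by rewrite Num.Theory.pnatr_eq0.
rewrite -natrM mul_bin_down natrM mulrA mulrCA.
rewrite divff ?Num.Theory.pnatr_eq0 // mulr1.
case: (leqP j n.+1) => jn; [by rewrite natrB | by rewrite bin_small // !mulr0].
Qed.

(** Compare the coefficients of t^(J+2). Pascal's rule and the two formulas
    above express every binomial by 'C(n, J), and what remains is an identity
    of rational functions in n and J. The coefficients of t^0 and t^1, for
    which J would be negative, are computed directly. *)
Lemma narayana_rec (n : nat) :
  n.+3%:R * narayana n.+2 =
    (n.*2 + 3)%:R * ((1 + 'X) * narayana n.+1)
      - n%:R * ((1 - 'X) ^+ 2 * narayana n).
Proof.
case: n => [|q].
  apply/polyP => j; rewrite mul0r subr0 -!polyC_natr [(1 + 'X) * _]mulrDl mul1r.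
  rewrite !coefCM coefD coefXM !coef_narayana.
  case: j => [|[|j]]; rewrite ?coef_narayana ?bin0 ?bin1 //=.
  rewrite (@bin_small 1 j.+2) // (@bin_small 0 j.+1) // (@bin_small 0 j.+2) //.
  by rewrite !(mulr0, mul0r, addr0).
apply/polyP => j.
have -> : (1 - 'X) ^+ 2 * narayana q.+1 =
    narayana q.+1 - (narayana q.+1 *+ 2) * 'X + narayana q.+1 * 'X * 'X by ring.
rewrite [(1 + 'X) * _]mulrDl mul1r -!polyC_natr coefB !coefCM.
rewrite !coefD coefXM !coefN !coefMX !coefMn.
have q0 (l : nat) : l.+1%:R != 0 :> rat by rewrite Num.Theory.pnatr_eq0.
have Pascal (l i : nat) :
    'C(l.+1, i.+1)%:R = 'C(l, i.+1)%:R + 'C(l, i)%:R :> rat.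
  by rewrite binS natrD.
case: j => [|[|J]] /=; rewrite ?coef_narayana ?bin0 ?bin1.
- by rewrite -muln2; field.
- by rewrite -muln2; field.
rewrite !(Pascal q.+2) !(Pascal q.+1) !(natr_bin_down q) !natr_bin_left -muln2.
by field; rewrite !nat1r -!natrD; apply/and4P; split; apply: q0.
Qed.

(** * Coefficients and the Euler derivation *)

Definition fps_const (c : {poly rat}) : fps := fun n => if n is 0 then c else 0.
Definition fps_var : fps := fun n => if n is 1 then 1 else 0.

(** The derivation x d/dx: unlike d/dx it does not shift indices, and its
    Leibniz rule holds term by term in the Cauchy product. *)
Definition fps_theta (f : fps) : fps := fun n => n%:R * f n.

Local Notation x := fps_var.
Local Notation t := (fps_const 'X).
Local Notation theta := fps_theta.

Lemma fps_coefD (f g : fps) n : (f + g) n = f n + g n. Proof. by []. Qed.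
Lemma fps_coefN (f : fps) n : (- f) n = - f n. Proof. by []. Qed.
Lemma fps_coef0 n : (0 : fps) n = 0. Proof. by []. Qed.
Lemma fps_coef1 n : (1 : fps) n = (n == 0%N)%:R.
Proof. by case: n. Qed.
Lemma fps_coefM (f g : fps) n : (f * g) n = \sum_(i < n.+1) f i * g (n - i)%N.
Proof. by []. Qed.

Lemma fps_coefM0 (f g : fps) : (f * g) 0%N = f 0%N * g 0%N.
Proof. by rewrite fps_coefM big_ord1. Qed.

Lemma fps_coef_exp0 (f : fps) n : (f ^+ n) 0%N = f 0%N ^+ n.
Proof. by elim: n => // n IHn; rewrite !exprS fps_coefM0 IHn. Qed.

Lemma fps_coefCM c (f : fps) n : (fps_const c * f) n = c * f n.
Proof.
rewrite fps_coefM big_ord_recl subn0 big1 ?addr0 // => i _.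
by rewrite mul0r.
Qed.

Lemma fps_coefXM0 (f : fps) : (x * f) 0%N = 0.
Proof. by rewrite fps_coefM0 mul0r. Qed.

Lemma fps_coefXMS (f : fps) n : (x * f) n.+1 = f n.
Proof.
rewrite fps_coefM 2!big_ord_recl big1 => [|i _]; last by rewrite mul0r.
by rewrite mul0r mul1r add0r addr0 subSS subn0.
Qed.

Lemma fps_coef_theta (f : fps) n : theta f n = n%:R * f n.
Proof. by []. Qed.

Definition fps_coefE := (fps_coefXM0, fps_coefXMS, fps_coefCM, fps_coefD,
  fps_coefN, fps_coef1, fps_coef0, fps_coef_theta).

Lemma fps_thetaM (f g : fps) : theta (f * g) = theta f * g + f * theta g.
Proof.
apply/funext => n; rewrite /theta fps_coefD !fps_coefM mulr_sumr -big_split.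
apply: eq_bigr => i _ /=; have le_in : (i <= n)%N by rewrite -ltnS.
have -> : n%:R = i%:R + (n - i)%:R :> {poly rat} by rewrite -natrD subnKC.
ring.
Qed.

Lemma fps_thetaD (f g : fps) : theta (f + g) = theta f + theta g.
Proof. by apply/funext => n; rewrite /theta !fps_coefE mulrDr. Qed.

Lemma fps_thetaN (f : fps) : theta (- f) = - theta f.
Proof. by apply/funext => n; rewrite /theta !fps_coefE mulrN. Qed.

Lemma fps_theta_var : theta x = x.
Proof. by apply/funext => -[|[|n]]; rewrite /theta ?mulr0 ?mulr1. Qed.

Lemma fps_theta_const c : theta (fps_const c) = 0.
Proof. by apply/funext => -[|n]; rewrite /theta ?mul0r ?mulr0. Qed.

Lemma fps_theta1 : theta 1 = 0.
Proof. by apply/funext => -[|n]; rewrite /theta ?mul0r ?mulr0. Qed.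

(** A homogeneous linear equation of first order, regular at 0, has no nonzero
    solution that vanishes at 0: the coefficient of x^n of the equation is
    n z_n = 0 once z_0, ..., z_(n-1) vanish. *)
Lemma fps_theta_eq0 (A E z : fps) :
  A 0%N = 1 -> E 0%N = 0 -> z 0%N = 0 -> A * theta z = E * z -> z = 0.
Proof.
move=> A0 E0 z0 ode; apply/funext => n; rewrite fps_coef0.
elim/ltn_ind: n => -[|n] // IHn; move/(congr1 (@^~ n.+1)): ode.
rewrite [A * _]mulrC [E * _]mulrC !fps_coefM !(big_ord_recr n.+1) /=.
rewrite subnn A0 E0 mulr0 mulr1 !big1 => [|i _|i _]; last 2 first.
- by rewrite IHn // mul0r.
- by rewrite /theta IHn // mulr0 mul0r.
rewrite add0r addr0 => /eqP; rewrite mulf_eq0 -polyC_natr polyC_eq0.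
by rewrite Num.Theory.pnatr_eq0 => /eqP.
Qed.

(** * The functional equations of c0 and c1 *)

Lemma c1E : c1 = 1 - t + t * c0.
Proof.
apply/funext => -[|n]; rewrite !fps_coefE ?subr0 ?add0r //.
by rewrite mulr1 subrK.
Qed.

(** The discriminant of t x c^2 - (1 - (1 - t) x) c + 1, as a quadratic in c. *)
Definition narayana_disc : fps := (1 - (1 - t) * x) ^+ 2 - (t * x) *+ 4.

(** The recurrence of the Narayana polynomials as a differential equation: y is
    a square root of the discriminant D, and this is D theta(y) =
    theta(D) y / 2. *)
Lemma narayana_theta (y := 2%:R * t * x * c0 - (1 - (1 - t) * x)) :
  narayana_disc * theta y = ((1 - t) ^+ 2 * x ^+ 2 - (1 + t) * x) * y.
Proof.
have yE : y = t * (x * c0) + t * (x * c0) - 1 + x * 1 - t * (x * 1).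
  by rewrite /y; ring.
have DE f : narayana_disc * f =
   f - (x * (f + f) + x * (t * (f + f)))
     + x * (x * (f - t * (f + f) + t * (t * f))).
  by rewrite /narayana_disc; ring.
have EE f : ((1 - t) ^+ 2 * x ^+ 2 - (1 + t) * x) * f =
   x * (x * (f - t * (f + f) + t * (t * f))) - (x * f + x * (t * f)) by ring.
have y0 : y 0%N = -1 by rewrite yE !fps_coefE /=; ring.
have y1 : y 1%N = 1 + 'X by rewrite yE !fps_coefE /c0 /=; ring.
have y2 n : y n.+2 = 2%:R * 'X * narayana n.+1.
  by rewrite yE !fps_coefE /=; ring.
have C1 : narayana 1 = 1.
  apply/polyP => j; rewrite coef_narayana coef1; case: j => [|j] //=.
  by rewrite (@bin_small 0) // mulr0 mul0r.
apply/funext => n; rewrite DE EE.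
case: n => [|[|[|n]]]; rewrite !fps_coefE ?y0 ?y1 ?y2 ?C1; try ring.
(* For n = 0 the coefficient y 1 = 1 + t is not 2 t C_0, but the factor n
   hides the difference. *)
have nC : n%:R * y n.+1 = 2%:R * 'X * (n%:R * narayana n).
  by case: n => [|n]; rewrite ?mul0r ?mulr0 // y2; ring.
have := narayana_rec n; rewrite -muln2 => rec.
(* The difference of the two sides is 2 t times that of the recurrence. *)
pose N1 := (n * 2 + 3)%:R * ((1 + 'X) * narayana n.+1).
pose N0 := n%:R * ((1 - 'X) ^+ 2 * narayana n).
apply/eqP; rewrite -subr_eq0; apply/eqP.
transitivity (2%:R * 'X * (n.+3%:R * narayana n.+2 - (N1 - N0))); last first.
  by rewrite rec subrr mulr0.
transitivity (2%:R * 'X * (n.+3%:R * narayana n.+2 - N1)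
                + (1 - 'X) ^+ 2 * (n%:R * y n.+1)).
  by rewrite /N1; ring.
by rewrite nC /N0; ring.
Qed.

(** By the differential equation for y, both y^2 and the discriminant D solve
    D theta(z) = theta(D) z, and both have constant term 1, so they agree.
    Their difference is 4 t x times the quadratic. *)
Lemma c0_quadratic : t * x * c0 ^+ 2 - (1 - (1 - t) * x) * c0 + 1 = 0.
Proof.
pose y := 2%:R * t * x * c0 - (1 - (1 - t) * x).
pose E := (1 - t) ^+ 2 * x ^+ 2 - (1 + t) * x.
have ode : narayana_disc * theta y = E * y := narayana_theta.
have coef0 : (y 0%N = -1) * (narayana_disc 0%N = 1) * (E 0%N = 0).
  have yE : y = x * (2%:R * t * c0) - 1 + x * (1 - t) by rewrite /y; ring.
  have dE : narayana_disc = 1 + x * ((1 - t) ^+ 2 * x - (1 - t) *+ 2 - t *+ 4).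
    by rewrite /narayana_disc; ring.
  have EE : E = x * ((1 - t) ^+ 2 * x - (1 + t)) by rewrite /E; ring.
  by rewrite yE dE EE !fps_coefE /=; split; [split|]; ring.
have yy : y ^+ 2 - narayana_disc = 0.
  apply: (fps_theta_eq0 narayana_disc (2%:R * E)).
  - by rewrite coef0.
  - by rewrite fps_coefM0 coef0 mulr0.
  - by rewrite expr2 fps_coefD fps_coefN fps_coefM0 !coef0; ring.
  have thD : theta narayana_disc = 2%:R * E.
    rewrite /narayana_disc /E expr2.
    rewrite !(fps_thetaM, fps_thetaD, fps_thetaN, fps_theta_var,
      fps_theta_const, fps_theta1, mulrS, mulr0n).
    ring.
  rewrite fps_thetaD fps_thetaN thD expr2 fps_thetaM.
  have -> : narayana_disc * (theta y * y + y * theta y - 2 * E)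
    = 2%:R * y * (narayana_disc * theta y) - 2%:R * E * narayana_disc by ring.
  by rewrite ode; ring.
set q := LHS.
have q0 : t * (x * (q + q + q + q)) = 0.
  have -> : t * (x * (q + q + q + q)) = y ^+ 2 - narayana_disc.
    by rewrite /q /y /narayana_disc; ring.
  exact: yy.
apply/funext => n; rewrite fps_coef0.
move/(congr1 (@^~ n.+1)): q0; rewrite !fps_coefE => /eqP.
have -> : q n + q n + q n + q n = 4%:R * q n by ring.
rewrite !mulf_eq0 polyX_eq0 /= -polyC_natr polyC_eq0.
by rewrite Num.Theory.pnatr_eq0 => /eqP.
Qed.

Lemma c0_rec : c0 = 1 + x * (c0 * c1).
Proof.
apply/eqP; rewrite -subr_eq0 -oppr_eq0 -c0_quadratic c1E; apply/eqP; ring.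
Qed.

Lemma c1_rec : c1 = 1 + t * (x * (c0 * c1)).
Proof. by rewrite {1}c1E {1}c0_rec; ring. Qed.

(** * The reciprocal of an odd power *)

Lemma cpow_odd k : cpow k.*2.+1 = c0 ^+ k.+1 * c1 ^+ k.
Proof.
have cpowS n : cpow n.+1 = cpow n * (if odd n then c1 else c0) by [].
elim: k => [|k IHk]; first by rewrite cpowS expr1 expr0 mulr1; apply: mul1r.
by rewrite doubleS 2!cpowS IHk /= odd_double /= !exprS; ring.
Qed.

(** The functional equations give the reciprocals 1 - x c1 of c0 and
    1 - t x c0 of c1; this is the reciprocal of cpow k.*2.+1. *)
Definition cpow_inv (k : nat) : fps :=
  (1 - x * c1) ^+ k.+1 * (1 - t * (x * c0)) ^+ k.

Lemma c0V : c0 * (1 - x * c1) = 1.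
Proof. by rewrite mulrBr mulr1 {1}c0_rec; ring. Qed.

Lemma c1V : c1 * (1 - t * (x * c0)) = 1.
Proof. by rewrite mulrBr mulr1 {1}c1_rec; ring. Qed.

Lemma cpow_invK k : cpow_inv k * cpow k.*2.+1 = 1.
Proof.
rewrite cpow_odd /cpow_inv mulrACA -!exprMn.
by rewrite ![(1 - _) * _]mulrC c0V c1V !expr1n mulr1.
Qed.

Definition fps_degle (d : nat) (f : fps) := forall n, (d < n)%N -> f n = 0.

Lemma fps_degleB d (f g : fps) :
  fps_degle d f -> fps_degle d g -> fps_degle d (f - g).
Proof. by move=> fd gd n dn; rewrite fps_coefD fps_coefN fd ?gd // subr0. Qed.

Lemma fps_degleM d e (f g : fps) :
  fps_degle d f -> fps_degle e g -> fps_degle (d + e) (f * g).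
Proof.
move=> fd ge n den; rewrite fps_coefM big1 // => i _.
by case: (ltnP d i) => di; [rewrite fd ?mul0r | rewrite ge ?mulr0 //; lia].
Qed.

(** For F = cpow k.*2.+1 this is t^(k+1) x^(2k+1) times the sum of F and its
    conjugate under u |-> 1/(t u), where u = x c0 c1. *)
Definition conj_sum (k : nat) : fps :=
  cpow_inv k + t ^+ k.+1 * (x ^+ k.*2.+1 * cpow k.*2.+1).

Section ConjSum.

(* Conjugation exchanges p and q, and also A and B; hence p + q, p q, A + B and
   A q + B p are rational functions of x and t, in fact polynomials. *)
Let A := 1 - x * c1.
Let B := t * x * c0.
Let p := (1 - x * c1) * (1 - t * (x * c0)).
Let q := t * x ^+ 2 * (c0 * c1).

Lemma conj_sumE k : conj_sum k = A * p ^+ k + B * q ^+ k.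
Proof.
rewrite /conj_sum cpow_odd /cpow_inv /A /B /p /q; congr (_ + _).
  by rewrite exprS exprMn -mulrA.
by rewrite !exprMn -exprD addnn !exprS; ring.
Qed.

Lemma conj_sumAB : A + B = 1 - (1 - t) * x.
Proof. by rewrite /A /B c1E; ring. Qed.

Lemma conj_sum_pq : (p + q = 1 - (1 + t) * x) * (p * q = t * x ^+ 2).
Proof.
split.
  have -> : p + q =
      1 - x * (c1 - t * (x * (c0 * c1))) - t * x * (c0 - x * (c0 * c1)).
    by rewrite /p /q; ring.
  have -> : c1 - t * (x * (c0 * c1)) = 1 by rewrite {1}c1_rec addrK.
  have -> : c0 - x * (c0 * c1) = 1 by rewrite {1}c0_rec addrK.
  ring.
have -> : p * q =
    t * x ^+ 2 * ((c0 * (1 - x * c1)) * (c1 * (1 - t * (x * c0)))).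
  by rewrite /p /q; ring.
by rewrite c0V c1V !mulr1.
Qed.

Lemma conj_sum_AqBp : A * q + B * p = t * x * (1 + x - t * x).
Proof.
have -> : A * q + B * p = t * x * (x * c1 * (c0 * (1 - x * c1)) +
    (c0 * (1 - x * c1)) * (1 - t * x * c0)).
  by rewrite /A /B /p /q; ring.
by rewrite c0V c1E; ring.
Qed.

(** By the description A p^k + B q^k the sums satisfy a linear recurrence with
    characteristic roots p and q; as p + q and p q have degrees 1 and 2, each
    step raises the degree by at most one. *)
Lemma conj_sum_deg k : fps_degle k.+1 (conj_sum k).
Proof.
have [pq_add pq_mul] := conj_sum_pq.
elim/ltn_ind: k => -[|[|k]] IHk.
- rewrite conj_sumE !expr0 !mulr1 conj_sumAB => -[|[|n]] // _.
  (* Factors 1 put the polynomials in the form that fps_coefE evaluates. *)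
  have -> : 1 - (1 - t) * x = 1 - x * 1 + x * (t * 1) by ring.
  by rewrite !fps_coefE /=; ring.
- rewrite conj_sumE !expr1.
  have -> : A * p + B * q = (A + B) * (p + q) - (A * q + B * p) by ring.
  rewrite conj_sumAB pq_add conj_sum_AqBp => -[|[|[|n]]] // _.
  have -> : (1 - (1 - t) * x) * (1 - (1 + t) * x) - t * x * (1 + x - t * x) =
     1 - x * 1 - x * 1 - t * (x * 1) + x * (x * 1) - t * (x * (x * 1)) by ring.
  by rewrite !fps_coefE /=; ring.
have -> : conj_sum k.+2 = (p + q) * conj_sum k.+1 - p * q * conj_sum k.
  by rewrite !conj_sumE !exprS; ring.
rewrite pq_add pq_mul; apply: fps_degleB.
  apply: (@fps_degleM 1 k.+2) (IHk _ _) => // -[|[|n]] // _.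
  have -> : 1 - (1 + t) * x = 1 - x * 1 - t * (x * 1) by ring.
  by rewrite !fps_coefE /=; ring.
apply: (@fps_degleM 2 k.+1) (IHk _ _) => // -[|[|[|n]]] // _.
have -> : t * x ^+ 2 = t * (x * (x * 1)) by ring.
by rewrite !fps_coefE /=; ring.
Qed.

End ConjSum.

Lemma fps_coefXnM (f : fps) d n :
  (x ^+ d * f) n = if (d <= n)%N then f (n - d)%N else 0.
Proof.
elim: d n => [|d IHd] n; first by rewrite expr0 mul1r subn0.
rewrite exprS -mulrA; case: n => [|n]; first by rewrite fps_coefXM0.
by rewrite fps_coefXMS IHd subSS.
Qed.

Lemma fps_coefCnM (f : fps) c d n : (fps_const c ^+ d * f) n = c ^+ d * f n.
Proof.
by elim: d => [|d IHd]; rewrite ?expr0 ?mul1r // !exprS -!mulrA fps_coefCM IHd.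
Qed.

(** For F = cpow k.*2.+1: beyond the degree of [conj_sum k], 1/F and
    - t^(k+1) x^(2k+1) F have the same coefficients. *)
Lemma cpow_inv_coef k n : (k.+1 < n)%N ->
  cpow_inv k n =
    - 'X ^+ k.+1 *
      (if (k.*2.+1 <= n)%N then cpow k.*2.+1 (n - k.*2.+1)%N else 0).
Proof.
move=> /conj_sum_deg /eqP; rewrite /conj_sum fps_coefD fps_coefCnM fps_coefXnM.
by rewrite addr_eq0 mulNr => /eqP.
Qed.

(** * The determinant identity *)

Lemma Ccoef_sub K (l d : nat) :
  Ccoef K (l%:Z - d%:Z) = if (d <= l)%N then cpow K (l - d)%N else 0.
Proof.
case: leqP => [dl|ld]; first by rewrite subzn.
by have -> : l%:Z - d%:Z = Negz (d - l).-1 by lia.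
Qed.

Lemma det_first_row0 (R : comNzRingType) n (M : 'M[R]_n.+1) :
  (forall j, M ord0 j = 0) -> \det M = 0.
Proof.
by move=> M0; rewrite (expand_det_row _ ord0) big1 // => j _; rewrite M0 mul0r.
Qed.

Theorem theorem4 (k m : nat) (hk : (0 < k)%N) (hm : (0 < m)%N) :
  (forall N : nat, (1 <= N)%N -> (N <= m + k - 2)%N ->
     hankelD (2 * k - 1)%N (2 - k%:Z - m%:Z) N = 0)
  /\
  (forall n : nat,
     hankelD (2 * k - 1)%N (2 - k%:Z - m%:Z) (n + m + k - 1)%N =
     (-1) ^+ 'C(m + k - 1, 2) * 'X^(k * n)
       * hankelD (2 * k - 1)%N (1 - k%:Z + m%:Z) n).
Proof.
(* From here on k and m stand for k - 1 and m - 1, so that p = k + m. *)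
case: k hk => // k _; case: m hm => // m _.
have -> : (2 * k.+1 - 1 = k.*2.+1)%N by lia.
have entry (i j : nat) : Ccoef k.*2.+1 (i%:Z + j%:Z + (2 - k.+1%:Z - m.+1%:Z)) =
    if (k + m <= i + j)%N then cpow k.*2.+1 (i + j - (k + m))%N else 0.
  by rewrite -Ccoef_sub; congr Ccoef; lia.
split=> [[|N] // _ Nkm | n].
  apply: det_first_row0 => j; rewrite mxE entry; case: leqP => //=.
  by have := ltn_ord j; lia.
have -> : (n + m.+1 + k.+1 - 1 = (k + m).+1 + n)%N by lia.
have -> : (m.+1 + k.+1 - 1 = (k + m).+1)%N by lia.
rewrite /hankelD; under eq_mx do rewrite entry.
rewrite (@hankel_reciprocal _ (cpow k.*2.+1) (cpow_inv k)); first last.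
- by move=> l; rewrite -fps_coefM cpow_invK fps_coef1.
- by rewrite cpow_odd fps_coefM0 !fps_coef_exp0 /c0 /c1 !expr1n mulr1.
pose H := \matrix_(i < n, j < n)
  Ccoef k.*2.+1 (i%:Z + j%:Z + (1 - k.+1%:Z + m.+1%:Z)).
have -> : \matrix_(i < n, j < n) cpow_inv k (i + j + (k + m).+2)%N
    = - 'X ^+ k.+1 *: H.
  apply/matrixP => i j; rewrite !mxE cpow_inv_coef; last by lia.
  by rewrite -Ccoef_sub; congr (_ * Ccoef _ _); lia.
rewrite detZ [(- 'X ^+ _) ^+ n]exprNn -exprM !mulrA.
by rewrite -[_ * _ * (-1) ^+ n]mulrA -expr2 sqrr_sign mulr1.
Qed.
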